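(* Let $f,g,h$ be three positive measurable functions on some measure space $(Y,\Sigma,\nu)$ and let $p,q\ge1$ be two numbers with $\frac1p+\frac1q=1$. The inequality $$\int_{U}f(y)\,d\nu(y)\le\bigg(\int_{U}g(y)^{p}\,d\nu(y)\bigg)^{\frac1p}\bigg(\int_{U}h(y)^{q}\,d\nu(y)\bigg)^{\frac1q}$$ holds for every $U\in\Sigma$ if and only if $f(y)\le g(y)h(y)$ for $\nu$-a.e. $y\in Y$.
   Context: Here $\Sigma$ is the $\sigma$-algebra of measurable subsets of $Y$ and $\nu$ is the measure on it; integrals of positive functions take values in $[0,\infty]$.
   Formalization: The ''only if'' direction is proved for semifinite measures (every set of infinite measure contains a subset of positive finite measure); it fails otherwise, e.g. on a single point of infinite measure with f=2, g=h=1. The ''if'' direction is for every measure. *)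

(* Defs.v *)
From HB Require Import structures.
From mathcomp Require Import all_boot all_order all_algebra.
From mathcomp Require Import all_classical all_reals all_analysis.
Import Order.TTheory GRing.Theory Num.Theory.
Import numFieldNormedType.Exports.

Set Implicit Arguments.
Unset Strict Implicit.
Unset Printing Implicit Defensive.

Local Open Scope classical_set_scope.
Local Open Scope ring_scope.
Local Open Scope ereal_scope.

(* Every sigma-finite measure is semifinite. What is excluded is a measurable
   set of infinite measure all of whose measurable subsets have measure 0
   or +oo. *)
Definition semifinite (d : measure_display) (Y : measurableType d)
    (R : realType) (nu : {measure set Y -> \bar R}) : Prop :=
  forall A : set Y, measurable A -> nu A = +oo ->
    exists B : set Y, [/\ measurable B, B `<=` A & 0 < nu B < +oo].

(* Main.v *)
(* If f <= g h a.e., the inequality on U is Hoelder's. For the other direction,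
   cover {f > g h} by the countably many sets {g <= a, h <= b, c <= f} with
   a, b, c rational and a b < c. If one of them had positive measure, it would
   contain a set D of positive finite measure m, and the inequality on D would
   give c m <= (a^p m)^(1/p) (b^q m)^(1/q) = a b m. *)
Require Import Defs.
From HB Require Import structures.
From mathcomp Require Import all_boot all_order all_algebra.
From mathcomp Require Import all_classical all_reals all_analysis.
From mathcomp Require Import measurable_realfun lra.
Import Order.TTheory GRing.Theory Num.Theory.
Import numFieldNormedType.Exports.

Local Open Scope classical_set_scope.
Local Open Scope ring_scope.
Local Open Scope ereal_scope.

(** Semifiniteness serves the case of infinite measure; a set of finite measure is its own
    witness. *)
Lemma semifinite_pos_subset (R : realType) (d : measure_display)
    (Y : measurableType d) (nu : {measure set Y -> \bar R}) (C : set Y) :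
  semifinite nu -> measurable C -> 0 < nu C ->
  exists D : set Y, [/\ measurable D, D `<=` C & 0 < nu D < +oo].
Proof.
move=> sf mC C0; have [Coo|] := eqVneq (nu C) +oo; first exact: sf.
by rewrite -ltey => Coo; exists C; split => //; rewrite C0.
Qed.

(** Decoding naturals with [unpickle] turns the union into a sequence; codes of no index, or of one
    outside [P], contribute the empty set. *)
Lemma negligible_bigcup_countType (R : realType) (d : measure_display)
    (Y : measurableType d) (nu : {measure set Y -> \bar R}) (I : countType)
    (P : set I) (F : I -> set Y) :
  (forall i, P i -> nu.-negligible (F i)) ->
  nu.-negligible (\bigcup_(i in P) F i).
Proof.
move=> nF.
pose G k := if unpickle k is Some i then [set y | P i /\ F i y] else set0.
apply: (@negligibleS _ _ _ _ (\bigcup_k G k)).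
  by move=> y [i Pi Fiy]; exists (pickle i) => //; rewrite /G pickleK.
apply: negligible_bigcup => k; rewrite /G.
case: (unpickle k) => [i|]; last exact: negligible_set0.
have [Pi|nPi] := pselect (P i); first by apply: negligibleS (nF _ Pi) => y [].
by apply: negligibleS (@negligible_set0 _ _ _ nu) => y [].
Qed.

(** Used with [x], [y], [z] the values of [g], [h], [f] at a point. Bounds in [rat] make the
    covering boxes countable in number. *)
Lemma mulr_lt_rat_bounds (R : realType) (x y z : R) :
  (0 <= x)%R -> (0 <= y)%R -> (x * y < z)%R ->
  exists abc : rat * rat * rat,
    [/\ (x <= ratr abc.1.1)%R, (y <= ratr abc.1.2)%R, (ratr abc.2 <= z)%R &
        (ratr abc.1.1 * ratr abc.1.2 < ratr abc.2 :> R)%R].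
Proof.
move=> x0 y0 xyz.
(* For [e] at most 1 and [t], (x + e)(y + e) = xy + e(x + y + e) <= xy + t(x + y + 1) = z. Rationals
   [a] and [b] strictly below x + e and y + e thus leave room for [c] between ab and z. *)
pose t := ((z - x * y) / (x + y + 1))%R.
have s0 : (0 < x + y + 1)%R by lra.
have t0 : (0 < t)%R by rewrite divr_gt0// subr_gt0.
have tE : (t * (x + y + 1) = z - x * y)%R by rewrite /t divfK// gt_eqF.
pose e := Num.min 1%R t.
have e0 : (0 < e)%R by rewrite lt_min ltr01.
have e1 : (e <= 1)%R by rewrite ge_min lexx.
have et : (e <= t)%R by rewrite ge_min lexx orbT.
have [a] := @rat_in_itvoo R x (x + e)%R ltac:(lra).
rewrite in_itv/= => /andP[xa ae].
have [b] := @rat_in_itvoo R y (y + e)%R ltac:(lra).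
rewrite in_itv/= => /andP[yb be].
have [c] := @rat_in_itvoo R (ratr a * ratr b)%R z ltac:(nra).
rewrite in_itv/= => /andP[abc cz].
by exists (a, b, c); split => //=; exact: ltW.
Qed.

Lemma integral_powR_le (R : realType) (d : measure_display)
    (Y : measurableType d) (nu : {measure set Y -> \bar R}) (D : set Y)
    (g : Y -> R) (p a : R) :
  measurable D -> nu D \is a fin_num -> measurable_fun setT g ->
  (forall y, 0 <= g y)%R -> (0 < p)%R -> (0 <= a)%R ->
  (forall y, D y -> g y <= a)%R ->
  (\int[nu]_(y in D) (g y `^ p)%:E) `^ p^-1 <=
  (a * fine (nu D) `^ p^-1)%:E.
Proof.
move=> mD Dfin mg g0 p0 a0 ga.
have D0 : (0 <= fine (nu D))%R by rewrite fine_ge0.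
(* The bound is the p-th root of the integral over [D] of the constant a^p, so monotonicity of the
   root and of the integral suffices. *)
have -> : (a * fine (nu D) `^ p^-1)%:E = ((a `^ p)%:E * nu D) `^ p^-1.
  rewrite -[in RHS](fineK Dfin) -EFinM poweR_EFin powRM ?powR_ge0//.
  by rewrite -powRrM mulfV ?gt_eqF// powRr1.
have I0 : 0 <= \int[nu]_(y in D) (g y `^ p)%:E.
  by apply: integral_ge0 => y _; rewrite lee_fin powR_ge0.
apply: gt0_ler_poweR.
- by rewrite invr_ge0 ltW.
- by rewrite in_itv/= I0 leey.
- by rewrite in_itv/= leey andbT mule_ge0// lee_fin powR_ge0.
- rewrite -integral_cst//; apply: ge0_le_integral => //.
  + by move=> y _; rewrite lee_fin powR_ge0.
  + apply/measurable_EFinP; apply: measurable_funTS.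
    exact: (measurableT_comp (measurable_powR _)).
  + move=> y /ga gya; rewrite lee_fin; apply: ge0_ler_powR;
      rewrite ?nnegrE//; exact: ltW.
Qed.

Lemma measurable_box (R : realType) (d : measure_display)
    (Y : measurableType d) (f g h : Y -> R) (a b c : R) :
  measurable_fun setT f -> measurable_fun setT g -> measurable_fun setT h ->
  measurable [set y | [/\ (g y <= a)%R, (h y <= b)%R & (c <= f y)%R]].
Proof.
move=> mf mg mh.
rewrite [X in measurable X](_ : _ = [set y | (g y <= a)%R] `&`
  [set y | (h y <= b)%R] `&` [set y | (c <= f y)%R]); last first.
  by apply/seteqP; split => y /=; [case|case=> -[]].
by apply: measurableI; [apply: measurableI|];
  rewrite -[X in measurable X]setTI; apply: measurable_fun_le.
Qed.

Lemma hoelder_box_null (R : realType) (d : measure_display)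
    (Y : measurableType d) (nu : {measure set Y -> \bar R})
    (f g h : Y -> R) (p q a b c : R) :
  semifinite nu ->
  measurable_fun setT f -> measurable_fun setT g -> measurable_fun setT h ->
  (forall y, 0 <= f y)%R -> (forall y, 0 <= g y)%R -> (forall y, 0 <= h y)%R ->
  (0 < p)%R -> (0 < q)%R -> (p^-1 + q^-1 = 1)%R ->
  (forall U : set Y, measurable U ->
      \int[nu]_(y in U) (f y)%:E <=
        (\int[nu]_(y in U) (g y `^ p)%:E) `^ p^-1 *
        (\int[nu]_(y in U) (h y `^ q)%:E) `^ q^-1) ->
  (a * b < c)%R ->
  nu [set y | [/\ (g y <= a)%R, (h y <= b)%R & (c <= f y)%R]] = 0.
Proof.
move=> sf mf mg mh f0 g0 h0 p0 q0 pq H abc.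
set C := [set _ | _].
have mC : measurable C by exact: measurable_box.
apply: contrapT => /eqP; rewrite -measure_gt0 => C0.
have [D [mD DC /andP[D0 Doo]]] := @semifinite_pos_subset _ _ _ _ _ sf mC C0.
have Dfin : nu D \is a fin_num by rewrite ge0_fin_numE.
(* A point of [D] forces [a] and [b] to be nonnegative, since they dominate [g] and [h] there. *)
have [y Dy] : D !=set0.
  by apply/set0P/eqP => DE; move: D0; rewrite DE measure0 ltxx.
have [gya hyb _] := DC _ Dy.
have a0 : (0 <= a)%R by exact: le_trans gya.
have b0 : (0 <= b)%R by exact: le_trans hyb.
have c0 : (0 <= c)%R by rewrite ltW// (le_lt_trans _ abc)// mulr_ge0.
have m0 : (0 < fine (nu D))%R by rewrite fine_gt0// D0.
have lb : (c * fine (nu D))%:E <= \int[nu]_(y in D) (f y)%:E.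
  rewrite EFinM fineK// -integral_cst//; apply: ge0_le_integral => //.
  - by apply/measurable_EFinP; exact: measurable_funTS.
  - by move=> z /DC[].
have ub : \int[nu]_(y in D) (f y)%:E <= (a * b * fine (nu D))%:E.
  (* As 1/p + 1/q = 1, the measure of [D] splits into one factor for each integral. *)
  have -> : (a * b * fine (nu D) =
      (a * fine (nu D) `^ p^-1) * (b * fine (nu D) `^ q^-1))%R.
    rewrite mulrACA -powRD ?pq ?powRr1// ?(ltW m0)//.
    by rewrite oner_eq0.
  apply: (le_trans (H _ mD)); rewrite EFinM.
  by apply: lee_pmul; rewrite ?poweR_ge0//; apply: integral_powR_le => //;
    move=> z /DC[].
(* Cancelling the positive finite measure of [D] leaves c <= ab, against [abc]. *)
have := le_trans lb ub; rewrite lee_fin ler_pM2r//.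
by rewrite leNgt abc.
Qed.

(** This is Hoelder's inequality on the whole space, applied to [g] and [h] extended by zero outside
    [U]. *)
Lemma hoelder_on (R : realType) (d : measure_display)
    (Y : measurableType d) (nu : {measure set Y -> \bar R}) (U : set Y)
    (g h : Y -> R) (p q : R) :
  measurable U -> measurable_fun setT g -> measurable_fun setT h ->
  (forall y, 0 <= g y)%R -> (forall y, 0 <= h y)%R ->
  (0 < p)%R -> (0 < q)%R -> (p^-1 + q^-1 = 1)%R ->
  \int[nu]_(y in U) (g y * h y)%:E <=
    (\int[nu]_(y in U) (g y `^ p)%:E) `^ p^-1 *
    (\int[nu]_(y in U) (h y `^ q)%:E) `^ q^-1.
Proof.
move=> mU mg mh g0 h0 p0 q0 pq.
have mUr (k : Y -> R) : measurable_fun setT k -> measurable_fun setT (k \_ U).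
  by move=> mk; apply/(measurable_restrictT _ mU)/measurable_funTS.
(* Off [U] the integrand of the norm is 0^r, which vanishes because r > 0. *)
have normE (k : Y -> R) r : (forall y, 0 <= k y)%R -> (0 < r)%R ->
    Lnorm nu r%:E (EFin \o (k \_ U)) =
    (\int[nu]_(y in U) (k y `^ r)%:E) `^ r^-1.
  move=> k0 r0; rewrite unlock; congr (_ `^ _).
  rewrite [RHS]integral_mkcond; apply: eq_integral => y _ /=.
  rewrite !patchE; case: ifPn => _ /=; first by rewrite ger0_norm.
  by rewrite normr0 powR0// gt_eqF.
have := @hoelder _ _ _ nu (g \_ U) (h \_ U) p q (mUr _ mg) (mUr _ mh) p0 q0 pq.
rewrite !normE//; apply: le_trans.
rewrite Lnorm1 integral_mkcond le_eqVlt; apply/orP; left; apply/eqP.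
apply: eq_integral => y _ /=; rewrite !patchE.
by case: ifPn => _ /=; rewrite ?mul0r ?normr0// ger0_norm// mulr_ge0.
Qed.

Theorem proposition1p4 (R : realType) (d : measure_display)
    (Y : measurableType d) (nu : {measure set Y -> \bar R})
    (f g h : Y -> R) (p q : R)
    (mf : measurable_fun setT f) (mg : measurable_fun setT g)
    (mh : measurable_fun setT h)
    (f0 : forall y, (0 <= f y)%R) (g0 : forall y, (0 <= g y)%R)
    (h0 : forall y, (0 <= h y)%R)
    (p1 : (1 <= p)%R) (q1 : (1 <= q)%R) (pq : (p^-1 + q^-1 = 1)%R) :
  (semifinite nu ->
    (forall U : set Y, measurable U ->
      \int[nu]_(y in U) (f y)%:E <=
        (\int[nu]_(y in U) (g y `^ p)%:E) `^ p^-1 *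
        (\int[nu]_(y in U) (h y `^ q)%:E) `^ q^-1) ->
    {ae nu, forall y, (f y <= g y * h y)%R}) /\
  ({ae nu, forall y, (f y <= g y * h y)%R} ->
    forall U : set Y, measurable U ->
      \int[nu]_(y in U) (f y)%:E <=
        (\int[nu]_(y in U) (g y `^ p)%:E) `^ p^-1 *
        (\int[nu]_(y in U) (h y `^ q)%:E) `^ q^-1).
Proof.
have p0 : (0 < p)%R by exact: lt_le_trans p1.
have q0 : (0 < q)%R by exact: lt_le_trans q1.
split=> [sf H|fgh U mU].
- pose P := [set abc : rat * rat * rat |
    (ratr abc.1.1 * ratr abc.1.2 < ratr abc.2 :> R)%R].
  pose F (abc : rat * rat * rat) := [set y | [/\ (g y <= ratr abc.1.1)%R,
    (h y <= ratr abc.1.2)%R & (ratr abc.2 <= f y)%R]].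
  apply: (@negligibleS _ _ _ _ (\bigcup_(abc in P) F abc)).
    (* Where f <= gh fails, gh < f holds strictly, and the rational bounds name a box containing the
       point. *)
    move=> y /= /negP; rewrite -ltNge => /mulr_lt_rat_bounds.
    by case=> // abc [ga hb cf ?]; exists abc.
  apply: negligible_bigcup_countType => abc Pabc.
  exists (F abc); split => //; first exact: measurable_box.
  exact: (@hoelder_box_null _ _ _ _ f g h p q).
(* It remains to compare the integrals of [f] and gh over [U], for which the a.e. inequality is
   enough. *)
- apply: le_trans (@hoelder_on _ _ _ nu U g h p q _ _ _ _ _ _ _ _) => //.
  apply: ae_ge0_le_integral => //.
  + by move=> y _; rewrite lee_fin.
  + by apply/measurable_EFinP; exact: measurable_funTS.
  + by move=> y _; rewrite lee_fin mulr_ge0.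
  + by apply/measurable_EFinP/measurable_funTS; exact: measurable_funM.
  + by apply: filterS fgh => y fy _; rewrite lee_fin.
Qed.
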